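(* Let $D$ be an integrally closed domain. Then every flat ideal of $D$ is complete.
   Context: $D$ is an integral domain with quotient field $K$. ''Ideal of $D$'' means fractional ideal: a $D$-submodule $I$ of $K$ with $dI\subseteq D$ for some nonzero $d\in D$. An ideal is flat if it is flat as a $D$-module. For an ideal $I$ of $D$, its $b$-closure is $I^b=\bigcap_\alpha IV_\alpha$, where the intersection is over all valuation overrings $V_\alpha$ of $D$ (valuation domains with $D\subseteq V_\alpha\subseteq K$, including $K$ itself). The ideal $I$ is complete if $I^b=I$. *)

(* Defs.v *)
From HB Require Import structures.
From mathcomp Require Import all_boot all_algebra fraction.
From mathcomp Require Import boolp classical_sets.

Set Implicit Arguments.
Unset Strict Implicit.
Unset Printing Implicit Defensive.

Import GRing.Theory.
Local Open Scope ring_scope.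
Local Open Scope classical_set_scope.

Notation "x %:F" := (@FracField.tofrac _ x) : ring_scope.

Section TensorFlat.
Variable R : comNzRingType.

(* The tensor product of M and N over R is the quotient of the finite formal
   sums of elementary tensors x (x) a, encoded as lists of pairs (x, a), by the
   least additive congruence that makes (x) biadditive and R-balanced. The list
   nil is zero, and - (x (x) a) is (- x) (x) a. *)
Inductive tensor_eq (M N : lmodType R) : seq (M * N) -> seq (M * N) -> Prop :=
| tensor_eq_refl s : tensor_eq s s
| tensor_eq_sym s t : tensor_eq s t -> tensor_eq t s
| tensor_eq_trans s t u : tensor_eq s t -> tensor_eq t u -> tensor_eq s u
| tensor_eq_cat s s' t t' :
    tensor_eq s s' -> tensor_eq t t' -> tensor_eq (s ++ t) (s' ++ t')
| tensor_eq_catC s t : tensor_eq (s ++ t) (t ++ s)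
| tensor_eq_0l a : tensor_eq [:: (0, a)] [::]
| tensor_eq_0r x : tensor_eq [:: (x, 0)] [::]
| tensor_eq_Dl x y a : tensor_eq [:: (x + y, a)] [:: (x, a); (y, a)]
| tensor_eq_Dr x a b : tensor_eq [:: (x, a + b)] [:: (x, a); (x, b)]
| tensor_eq_Z r x a : tensor_eq [:: (r *: x, a)] [:: (x, r *: a)].

(* The map id (x) f, on formal sums. *)
Definition tensor_map (M A B : lmodType R) (f : A -> B) (s : seq (M * A)) :
  seq (M * B) := [seq (p.1, f p.2) | p <- s].

(* Tensoring with M is right exact, so it is exact if and only if it preserves
   injectivity. *)
Definition flat (M : lmodType R) : Prop :=
  forall (A B : lmodType R) (f : {linear A -> B}), injective f ->
  forall s t : seq (M * A),
    tensor_eq (tensor_map f s) (tensor_map f t) -> tensor_eq s t.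

End TensorFlat.

Section FracModule.
Variable D : idomainType.
Local Notation K := {fraction D}.

Definition frac_scale (d : D) (x : K) : K := d%:F * x.

Fact frac_scaleA (a b : D) (x : K) :
  frac_scale a (frac_scale b x) = frac_scale (a * b) x.
Proof. by rewrite /frac_scale rmorphM mulrA. Qed.

Fact frac_scale1 : left_id 1 frac_scale.
Proof. by move=> x; rewrite /frac_scale rmorph1 mul1r. Qed.

Fact frac_scaleDr : right_distributive frac_scale +%R.
Proof. by move=> d x y; rewrite /frac_scale mulrDr. Qed.

Fact frac_scaleDl (x : K) : {morph frac_scale^~ x : a b / a + b}.
Proof. by move=> a b; rewrite /frac_scale rmorphD mulrDl. Qed.

HB.instance Definition _ := GRing.Zmodule_isLmodule.Build D {fraction D}
  frac_scaleA frac_scale1 frac_scaleDr frac_scaleDl.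

Lemma frac_scaleE (d : D) (x : K) : d *: x = d%:F * x.
Proof. by []. Qed.

End FracModule.

Record fractional_ideal (D : idomainType) := FractionalIdeal {
  ideal_set :> set {fraction D};
  ideal_submod : submod_closed (fun x : {fraction D} => `[< ideal_set x >]);
  ideal_denom : exists2 d : D, d != 0 &
    forall x, ideal_set x -> exists e : D, d *: x = e%:F
}.

Section IdealModule.
Variables (D : idomainType) (I : fractional_ideal D).

Definition ideal_pred : {pred {fraction D}} := fun x => `[< ideal_set I x >].

HB.instance Definition _ :=
  GRing.isSubmodClosed.Build D {fraction D} ideal_pred (ideal_submod I).

(* The ideal I viewed as an abstract D-module. *)
Record ideal_mod := IdealMod {
  ideal_val :> {fraction D};
  _ : ideal_val \in ideal_pred
}.

HB.instance Definition _ := [isSub for ideal_val].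
HB.instance Definition _ := [Choice of ideal_mod by <:].
HB.instance Definition _ := [SubChoice_isSubLmodule of ideal_mod by <:].

End IdealModule.

Section Completeness.
Variable D : idomainType.
Local Notation K := {fraction D}.

Definition integrally_closed : Prop :=
  forall x : K, integralOver (@FracField.tofrac D) x -> exists d : D, x = d%:F.

(* An overring of D has quotient field K, so it is a valuation domain when it
   contains x or x^-1 for every nonzero x in K. *)
Record valuation_overring (V : set K) : Prop := ValuationOverring {
  overring_subring : subring_closed (fun x : K => `[< V x >]);
  overring_base : forall d : D, V d%:F;
  overring_valuation : forall x : K, x != 0 -> V x \/ V x^-1
}.

Definition set_prod (A B : set K) : set K :=
  [set x | exists2 s : seq (K * K),
     (forall p, p \in s -> A p.1 /\ B p.2) & x = \sum_(p <- s) p.1 * p.2].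

Definition b_closure (I : set K) : set K :=
  \bigcap_(V in valuation_overring) set_prod I V.

Definition complete (I : set K) : Prop := b_closure I = I.

End Completeness.

(* Main.v *)
Require Import Defs.
From HB Require Import structures.
From mathcomp Require Import all_boot all_algebra fraction.
From mathcomp Require Import boolp classical_sets.
From mathcomp Require Import ring.

Set Implicit Arguments.
Unset Strict Implicit.
Unset Printing Implicit Defensive.

Import GRing.Theory.
Local Open Scope ring_scope.
Local Open Scope classical_set_scope.

(** Let x be a nonzero element of the b-closure of the flat ideal I.

    Membership of x in all the IV is first turned into integral equations. If
    the nonunital D-subalgebra of K generated by the fractions a / x, with a in
    I, did not contain 1, then Zorn's lemma would enlarge it to a nonunital
    D-subalgebra Q maximal for not containing 1. The multiplier ring
    V = (Q : Q) is then a valuation overring of which Q is a proper ideal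
    ([chevalley]). Writing x = \sum_i a_i v_i in IV gives
    1 = \sum_i (a_i / x) v_i in Q, which is absurd. So 1 is a polynomial
    expression without constant term in finitely many a / x; let J be the
    finite set of the a in I that occur. If t J is contained in D, multiplying
    by a power of t x turns that expression into a monic equation for t x over
    D ([alg_span_colon], [colon_integral]), whence t x lies in D.

    Flatness provides enough such t: for every finite subset J of a nonzero
    flat ideal I there are y_j in I and t_j with t_j J contained in D and
    \sum_j y_j t_j = 1 ([flat_ideal_invertible]). This is a form of the
    equational criterion for the relations b a = a b between the elements a, b
    of J. Then x = \sum_j y_j (t_j x) lies in I. *)

(** * Valuation rings dominating a nonunital algebra *)

Section Chevalley.
Variables (D : nzRingType) (K : fieldType) (phi : {rmorphism D -> K}).
Implicit Types (A Q : set K) (u x y : K).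

(** Nonunital D-subalgebras of K that avoid 1. Membership of 0 is not part of
    the axioms, so that the empty set qualifies and unions of arbitrary chains,
    including the empty one, stay in the class. *)
Record proper_subalg Q : Prop := ProperSubalg {
  psubalgD : forall x y, Q x -> Q y -> Q (x + y);
  psubalgM : forall x y, Q x -> Q y -> Q (x * y);
  psubalgZ : forall d x, Q x -> Q (phi d * x);
  psubalg1 : ~ Q 1
}.

Inductive alg_span A : K -> Prop :=
| alg_span_mem x : A x -> alg_span A x
| alg_spanD x y : alg_span A x -> alg_span A y -> alg_span A (x + y)
| alg_spanM x y : alg_span A x -> alg_span A y -> alg_span A (x * y)
| alg_spanZ d x : alg_span A x -> alg_span A (phi d * x).

Definition multipliers Q : set K := [set v | forall q, Q q -> Q (v * q)].

Lemma maximal_psubalg Q0 : Q0 !=set0 -> proper_subalg Q0 ->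
  exists Q, [/\ proper_subalg Q, Q0 `<=` Q &
    forall Q', proper_subalg Q' -> Q `<=` Q' -> Q' `<=` Q].
Proof.
move=> [z0 Q0z0] algQ0.
pose P Q := proper_subalg Q /\ (Q !=set0 -> Q0 `<=` Q).
(* The clause on nonempty Q lets the empty union through; the maximal element
   is nonempty because Q0 itself satisfies P. *)
have [F FP totF|Q [[algQ Q0Q] maxQ]] := @Zorn_bigcup K P.
  have join X Y x y : F X -> F Y -> X x -> Y y ->
      exists Z, [/\ F Z, Z x & Z y].
    move=> FX FY Xx Yy; have [XY|YX] := totF _ _ FX FY.
      by exists Y; split => //; apply: XY.
    by exists X; split => //; apply: YX.
  split; last first.
    move=> [x [X FX Xx]] y Q0y; exists X => //.
    by apply: (FP _ FX).2 => //; exists x.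
  split=> [x y [X FX Xx] [Y FY Yy]|x y [X FX Xx] [Y FY Yy]|d x [X FX Xx]|].
  - have [Z [FZ Zx Zy]] := join _ _ _ _ FX FY Xx Yy.
    by exists Z => //; apply: psubalgD (FP _ FZ).1 _ _ Zx Zy.
  - have [Z [FZ Zx Zy]] := join _ _ _ _ FX FY Xx Yy.
    by exists Z => //; apply: psubalgM (FP _ FZ).1 _ _ Zx Zy.
  - by exists X => //; apply: psubalgZ (FP _ FX).1 _ _ Xx.
  - by case=> X FX X1; apply: (psubalg1 (FP _ FX).1).
have Q0subQ : Q0 `<=` Q.
  apply: Q0Q; apply/set0P/negP => /eqP Qe.
  apply: (maxQ Q0); last by split=> [//|_ x].
  by rewrite Qe; split=> [//|/(_ _ Q0z0)].
exists Q; split => // Q' algQ' QQ'; apply: contrapT => nQ'Q.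
apply: (maxQ Q'); first by split.
by split => // _; apply: subset_trans QQ'.
Qed.

Section Multipliers.
Variable Q : set K.
Hypotheses (algQ : proper_subalg Q) (Q_neq0 : Q !=set0).
Hypothesis maxQ : forall Q', proper_subalg Q' -> Q `<=` Q' -> Q' `<=` Q.

Let V := multipliers Q.
Let QD := psubalgD algQ.
Let QM := psubalgM algQ.
Let QZ := psubalgZ algQ.

Let Q0 : Q 0.
Proof. by case: Q_neq0 => x /(QZ 0); rewrite rmorph0 mul0r. Qed.

Let QN x : Q x -> Q (- x).
Proof. by move=> /(QZ (-1)); rewrite rmorphN1 mulN1r. Qed.

Let Qsum n (f : 'I_n -> K) : (forall i, Q (f i)) -> Q (\sum_(i < n) f i).
Proof. by move=> Qf; elim/big_ind: _ => // x y; apply: QD. Qed.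

Lemma multipliers_subring : subring_closed (fun v : K => `[< V v >]).
Proof.
split=> [|v w /asboolP Vv /asboolP Vw|v w /asboolP Vv /asboolP Vw];
  apply/asboolP => q Qq; first by rewrite mul1r.
- by rewrite mulrBl; apply: QD; [exact: Vv|exact/QN/Vw].
- by rewrite -mulrA; apply/Vv/Vw.
Qed.

(** Q lies in the Jacobson radical of V: the elements that some power of 1 - a
    sends into Q form a subalgebra avoiding 1, since all powers of 1 - a are
    congruent to 1 modulo Q. By maximality it is Q. *)
Lemma multipliers_inv1B a : Q a -> V (1 - a)^-1.
Proof.
move=> Qa.
have QXB k : Q (1 - (1 - a) ^+ k).
  elim: k => [|k IHk]; first by rewrite expr0 subrr.
  have -> : 1 - (1 - a) ^+ k.+1 =
      (1 - (1 - a) ^+ k) + (a - (1 - (1 - a) ^+ k) * a).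
    by rewrite exprS; ring.
  by apply: (QD IHk); apply: (QD Qa); apply/QN/QM.
have QXM k q : Q q -> Q ((1 - a) ^+ k * q).
  move=> Qq; have -> : (1 - a) ^+ k * q = q - (1 - (1 - a) ^+ k) * q by ring.
  by apply: QD => //; apply/QN/QM.
have a1 : 1 - a != 0.
  by apply/eqP => /subr0_eq a1; apply: (psubalg1 algQ); rewrite a1.
pose Q' := [set y | exists k, Q ((1 - a) ^+ k * y)].
have Q'Q : Q' `<=` Q.
  apply: maxQ; last by move=> q Qq; exists 0%N; rewrite mul1r.
  split=> [x y [k Qx] [l Qy]|x y [k Qx] [l Qy]|d x [k Qx]|[k]].
  - exists (k + l)%N; rewrite mulrDr {1}addnC !exprD -!mulrA.
    by apply: QD; apply: QXM.
  - by exists (k + l)%N; rewrite exprD mulrACA; apply: QM.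
  - by exists k; rewrite mulrCA; apply: QZ.
  - rewrite mulr1 => Qk; apply: (psubalg1 algQ).
    by rewrite -(subrK ((1 - a) ^+ k) 1); apply: QD.
by move=> q Qq; apply: Q'Q; exists 1%N; rewrite expr1 mulVKf.
Qed.

(** The polynomial expressions in u with coefficients in Q form a subalgebra
    stable under u; it contains Q, and if it avoids 1, then it equals Q by
    maximality. *)
Lemma multipliersPn u : ~ V u ->
  exists2 p : {poly K}, (forall i, Q p`_i) & p.[u] = 1.
Proof.
move=> nVu; apply: contrapT => nQu1; apply: nVu => q Qq.
pose Q' := [set y | exists2 p : {poly K}, (forall i, Q p`_i) & p.[u] = y].
have Q'Q : Q' `<=` Q.
  apply: maxQ; last first.
    move=> r Qr; exists r%:P; last by rewrite hornerC.
    by move=> i; rewrite coefC; case: ifP.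
  split=> // [x y [p Qp <-] [r Qr <-]|x y [p Qp <-] [r Qr <-]|d x [p Qp <-]].
  - by exists (p + r); rewrite ?hornerD // => i; rewrite coefD; apply: QD.
  - exists (p * r); rewrite ?hornerM // => i; rewrite coefM.
    by apply: Qsum => j; apply: QM.
  - by exists (phi d *: p); rewrite ?hornerZ // => i; rewrite coefZ; apply: QZ.
apply: Q'Q; exists (q *: 'X); last by rewrite hornerZ hornerX mulrC.
by move=> i; rewrite coefZ coefX; case: eqP; rewrite ?mulr1 ?mulr0.
Qed.

(** The descent in Chevalley's extension theorem: the relation of lower degree,
    say that of u^-1, has an invertible 1 - q_0, so it expresses u^n through
    lower powers of u and decreases the degree n of the other relation. *)
Lemma no_inverse_relations N u (p q : {poly K}) : u != 0 ->
  (size p + size q <= N)%N -> (forall i, Q p`_i) -> (forall i, Q q`_i) ->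
  p.[u] = 1 -> q.[u^-1] = 1 -> False.
Proof.
elim: N u p q => [|N IHN] u p q u0 leN Qp Qq pu qu.
  move: leN pu; rewrite leqn0 addn_eq0 size_poly_eq0 => /andP[/eqP-> _].
  by rewrite horner0 => /esym/eqP; rewrite oner_eq0.
wlog le_qp : u p q u0 leN Qp Qq pu qu / (size q <= size p)%N.
  have [le_qp|/ltnW le_pq] := leqP (size q) (size p).
    by move/(_ u p q); apply.
  by move/(_ u^-1 q p); apply; rewrite ?invr_eq0 ?invrK // addnC.
case sp : (size p) => [|n].
  move/eqP: sp pu; rewrite size_poly_eq0 => /eqP->.
  by rewrite horner0 => /esym/eqP; rewrite oner_eq0.
rewrite sp in le_qp leN.
pose c := (1 - q`_0)^-1.
have c0 : 1 - q`_0 != 0.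
  by apply/eqP => /subr0_eq q1; apply: (psubalg1 algQ); rewrite q1.
(* q.[u^-1] = 1 yields u ^+ n = c * \sum_(i < n) q_(n - i) u ^+ i; p1 is p
   after substituting this for u ^+ n. *)
pose p1 := \poly_(i < n) (p`_i + p`_n * (c * q`_(n - i))).
have rev_q : \sum_(i < n) q`_(n - i) * u ^+ i = u ^+ n * (1 - q`_0).
  rewrite -{1}qu (horner_coef_wide _ le_qp) big_ord_recl expr0 mulr1.
  rewrite [q`_ _ + _]addrC addrK (reindex_inj rev_ord_inj) mulr_sumr.
  apply: eq_bigr => i _; rewrite lift0 /= subKn // exprVn mulrCA; congr (_ * _).
  by apply: (canRL (mulfK (expf_neq0 _ u0))); rewrite -exprD subnK.
apply: (IHN u p1 q) => //.
- by rewrite -ltnS; apply: leq_trans leN; rewrite ltn_add2r ltnS size_poly.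
- move=> i; rewrite coef_poly; case: ifP => // _.
  apply: QD => //; apply: QM => //; exact: multipliers_inv1B.
- rewrite horner_poly -pu horner_coef sp big_ord_recr /=.
  under eq_bigr do rewrite mulrDl -!mulrA.
  rewrite big_split -!mulr_sumr rev_q /=; congr (_ + _ * _).
  by rewrite mulrCA mulVf // mulr1.
Qed.

Lemma multipliers_valuation u : u != 0 -> V u \/ V u^-1.
Proof.
move=> u0; have [Vu|nVu] := pselect (V u); first by left.
right; apply: contrapT => nVu'.
have [p Qp pu] := multipliersPn nVu.
have [q Qq qu] := multipliersPn nVu'.
exact: no_inverse_relations u0 (leqnn _) Qp Qq pu qu.
Qed.

End Multipliers.

(** Chevalley's extension theorem, in the form in which the valuation ring is
    the multiplier ring of a maximal nonunital subalgebra. *)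
Theorem chevalley A : A !=set0 -> ~ alg_span A 1 ->
  exists V Q : set K,
  [/\ subring_closed (fun v : K => `[< V v >]), forall d, V (phi d),
      forall u, u != 0 -> V u \/ V u^-1, A `<=` Q &
      [/\ Q 0, forall x y, Q x -> Q y -> Q (x + y),
          forall x v, Q x -> V v -> Q (x * v) & ~ Q 1]].
Proof.
move=> [a Aa] nA1.
have algA : proper_subalg (alg_span A).
  by split=> //; [exact: alg_spanD|exact: alg_spanM|exact: alg_spanZ].
have [|Q [algQ AQ maxQ]] := maximal_psubalg _ algA.
  by exists a; apply: alg_span_mem.
have Q_neq0 : Q !=set0 by exists a; apply/AQ/alg_span_mem.
exists (multipliers Q), Q; split.
- exact: multipliers_subring.
- by move=> d q; apply: psubalgZ.
- exact: multipliers_valuation.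
- by move=> x Ax; apply/AQ/alg_span_mem.
- split=> [|||/(psubalg1 algQ)//].
  + by case: Q_neq0 => x /(psubalgZ algQ 0); rewrite rmorph0 mul0r.
  + exact: psubalgD.
  + by move=> x v Qx Vv; rewrite mulrC; apply: Vv.
Qed.

End Chevalley.

(** * Products and colons of sets of fractions *)

Section SetProd.
Variable D : idomainType.
Implicit Types A B : set {fraction D}.

Lemma set_prod_mem A B x y : A x -> B y -> set_prod A B (x * y).
Proof.
by move=> Ax By; exists [:: (x, y)]; rewrite ?big_seq1 // => p /[!inE] /eqP->.
Qed.

Lemma set_prod0 A B : set_prod A B 0.
Proof. by exists [::]; rewrite ?big_nil. Qed.

Lemma set_prodD A B x y :
  set_prod A B x -> set_prod A B y -> set_prod A B (x + y).
Proof.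
move=> [s sAB ->] [t tAB ->]; exists (s ++ t); rewrite ?big_cat // => p.
by rewrite mem_cat => /orP[/sAB|/tAB].
Qed.

Lemma set_prodN A B x : (forall y, B y -> B (- y)) ->
  set_prod A B x -> set_prod A B (- x).
Proof.
move=> BN [s sAB ->]; exists [seq (p.1, - p.2) | p <- s].
  by move=> _ /mapP[p /sAB[Ap Bp] ->]; split=> //; apply: BN.
by rewrite big_map -sumrN; apply: eq_bigr => p _; rewrite mulrN.
Qed.

End SetProd.

Section Colon.
Variable D : idomainType.
Implicit Types J : set {fraction D}.

Definition colon J : set {fraction D} :=
  [set t | forall b, J b -> exists e : D, t * b = e%:F].

Lemma colonS J J' : J `<=` J' -> colon J' `<=` colon J.
Proof. by move=> JJ' t tJ' b /JJ'/tJ'. Qed.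

Lemma colonN J t : colon J t -> colon J (- t).
Proof. by move=> tJ b /tJ[e tb]; exists (- e); rewrite mulNr tb rmorphN. Qed.

End Colon.

(** * Finite subsets of a flat ideal *)

Section TensorLemmas.
Variables (R : comNzRingType) (M N : lmodType R).

Lemma tensor_eq_map T (f g : T -> M * N) (r : seq T) :
  (forall i, tensor_eq [:: f i] [:: g i]) -> tensor_eq (map f r) (map g r).
Proof.
move=> fg; elim: r => [|i r IHr] /=; first exact: tensor_eq_refl.
by apply: (@tensor_eq_cat R M N [:: _] [:: _]).
Qed.

Lemma tensor_eq_sumr T (x : M) (F : T -> N) (r : seq T) :
  tensor_eq [:: (x, \sum_(i <- r) F i)] [seq (x, F i) | i <- r].
Proof.
elim: r => [|i r IHr] /=; first by rewrite big_nil; apply: tensor_eq_0r.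
rewrite big_cons; apply: tensor_eq_trans (tensor_eq_Dr _ _ _) _.
apply: (@tensor_eq_cat R M N [:: _] [:: _] [:: _]) => //.
exact: tensor_eq_refl.
Qed.

End TensorLemmas.

(** The submodule D beta + alpha D^k of D^k is the test module for flatness.
    When beta / alpha is the row of the b_i / a, the c in D with c beta in
    alpha D^k are those with (c / a) b_i in D for all i, so the coefficient of
    beta records a quotient by a colon while everything stays inside D^k. *)
Section RowSubmodule.
Variables (D : idomainType) (k : nat) (alpha : D) (beta : 'rV[D]_k).

Definition rowsub_pred : {pred 'rV[D]_k} :=
  fun v => `[< exists c e, v = c *: beta + alpha *: e >].

Fact rowsub_submod : submod_closed rowsub_pred.
Proof.
split=> [|d v w /asboolP[c [e ->]] /asboolP[c' [e' ->]]]; apply/asboolP.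
  by exists 0, 0; rewrite scale0r scaler0 addr0.
exists (d * c + c'), (d *: e + e').
by rewrite !scalerDr scalerDl !scalerA addrACA (mulrC alpha).
Qed.

HB.instance Definition _ :=
  GRing.isSubmodClosed.Build D 'rV[D]_k rowsub_pred rowsub_submod.

Record rowsub_mod := RowsubMod {
  rowsub_val :> 'rV[D]_k;
  _ : rowsub_val \in rowsub_pred
}.

HB.instance Definition _ := [isSub for rowsub_val].
HB.instance Definition _ := [Choice of rowsub_mod by <:].
HB.instance Definition _ := [SubChoice_isSubLmodule of rowsub_mod by <:].

Lemma rowsubP (v : rowsub_mod) :
  exists c, exists e, val v = c *: beta + alpha *: e.
Proof. by have /asboolP := valP v. Qed.

(** An arbitrary choice: the coefficient of beta is not unique. *)
Definition beta_coef (v : rowsub_mod) : D := projT1 (cid (rowsubP v)).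

Lemma beta_coefP v : exists e, val v = beta_coef v *: beta + alpha *: e.
Proof. exact: projT2 (cid (rowsubP v)). Qed.

Lemma rowsub_beta : beta \in rowsub_pred.
Proof. by apply/asboolP; exists 1, 0; rewrite scale1r scaler0 addr0. Qed.

Lemma rowsub_alpha e : alpha *: e \in rowsub_pred.
Proof. by apply/asboolP; exists 0, e; rewrite scale0r add0r. Qed.

End RowSubmodule.

Section FlatIdeal.
Variables (D : idomainType) (I : fractional_ideal D).
Local Notation K := {fraction D}.

(** The elements a and b_i of I are brought to the common denominator delta,
    with numerators alpha and beta_i. *)
Section CommonDenominator.
Variables (k : nat) (delta alpha : D) (beta : 'rV[D]_k).
Variables (a : ideal_mod I) (b : 'I_k -> ideal_mod I).
Hypotheses (delta0 : delta != 0) (a0 : val a != 0).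
Hypotheses (aE : delta%:F * val a = alpha%:F).
Hypotheses (bE : forall i, delta%:F * val (b i) = (beta 0 i)%:F).

Let J : set K := val a |` [set val (b i) | i in [set: 'I_k]].
Let A := rowsub_mod alpha beta.

Let deltaF : delta%:F != 0 :> K.
Proof. by rewrite tofrac_eq0. Qed.

(** The ambiguity of the coefficient of beta: two of its values c, c' at v have
    (c - c') beta in alpha D^k. *)
Lemma beta_coef_colon (v : A) c e : val v = c *: beta + alpha *: e ->
  colon J ((beta_coef v - c)%:F / val a).
Proof.
move=> vE _ [-> | [i _ <-]]; first by exists (beta_coef v - c); rewrite divfK.
have [e' vE'] := beta_coefP v; exists ((e - e') 0 i).
have cE : (beta_coef v - c) * beta 0 i = alpha * (e - e') 0 i.
  have /rowP/(_ i) : (beta_coef v - c) *: beta = alpha *: (e - e').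
    apply/eqP; rewrite scalerBl scalerBr subr_eq addrAC -subr_eq opprK.
    by rewrite -vE' vE addrC.
  by rewrite !mxE.
apply: (mulfI deltaF); apply: (mulIf a0).
transitivity ((beta_coef v - c)%:F * (delta%:F * val (b i))).
  by rewrite -mulrA [_ / _ * _]mulrAC divfK // mulrCA.
by rewrite bE -rmorphM cE rmorphM /= -aE mulrAC.
Qed.

(** The functional x (x) v |-> x c(v) / a, with c(v) the coefficient of beta in
    v, on formal sums. It descends to the tensor product modulo I (D : J). *)
Definition beta_sum (s : seq (ideal_mod I * A)) : K :=
  \sum_(p <- s) val p.1 * ((beta_coef p.2)%:F / val a).

Let prodJ := set_prod I (colon J).

Let prodJ_mem (x : ideal_mod I) t : colon J t -> prodJ (val x * t).
Proof. by apply: set_prod_mem; have /asboolP := valP x. Qed.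

Lemma beta_sum_congr s t : tensor_eq s t -> prodJ (beta_sum s - beta_sum t).
Proof.
rewrite /beta_sum; elim=> {s t}.
- by move=> s; rewrite subrr; apply: set_prod0.
- by move=> s t _ IH; rewrite -opprB; apply: set_prodN IH; apply: colonN.
- move=> s t u _ IH1 _ IH2; rewrite -(subrKA (beta_sum t)).
  by apply: set_prodD.
- move=> s s' t t' _ IH1 _ IH2; rewrite !big_cat /= opprD addrACA.
  by apply: set_prodD.
- by move=> s t; rewrite !big_cat /= [X in X - _]addrC subrr; apply: set_prod0.
- by move=> v; rewrite big_seq1 big_nil subr0 /= mul0r; apply: set_prod0.
- move=> x; rewrite big_seq1 big_nil subr0 /=.
  apply: prodJ_mem; rewrite -[beta_coef 0]subr0.
  apply: (beta_coef_colon (e := 0)).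
  by rewrite scale0r scaler0 addr0 linear0.
- move=> x y v; rewrite big_seq1 big_cons big_seq1 /= mulrDl subrr.
  exact: set_prod0.
- move=> x v w; rewrite big_seq1 big_cons big_seq1 /=.
  rewrite -mulrDr -mulrBr -mulrDl -mulrBl.
  apply: prodJ_mem; rewrite -rmorphD -rmorphB.
  have [e ve] := beta_coefP v; have [e' we] := beta_coefP w.
  apply: (beta_coef_colon (e := e + e')).
  by rewrite linearD /= ve we scalerDl scalerDr addrACA.
- move=> r x v; rewrite !big_seq1 /= frac_scaleE.
  set u := beta_coef v; set w := beta_coef _.
  have -> : r%:F * val x * (u%:F / val a) - val x * (w%:F / val a) =
      val x * - ((w - r * u)%:F / val a).
    rewrite [RHS]mulrN rmorphB rmorphM mulrBl mulrBr opprB -!mulrA.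
    by rewrite mulrCA.
  apply/prodJ_mem/colonN; have [e ve] := beta_coefP v.
  apply: (beta_coef_colon (e := r *: e)).
  by rewrite linearZ /= ve scalerDr !scalerA (mulrC alpha).
Qed.

(** In I (x) D^k the tensor a (x) beta equals \sum_i b_i (x) alpha eps_i, as
    beta_i a = alpha b_i. By flatness the equality already holds in
    I (x) (D beta + alpha D^k), where [beta_sum] sends the left side to 1 and
    the right side to 0, modulo I (D : J). *)
Lemma flat_one_in_prod : flat (ideal_mod I) -> prodJ 1.
Proof.
move=> flatI.
pose f : {linear A -> 'rV[D]_k} := val.
have inj_f : injective f by exact: val_inj.
pose va : A := RowsubMod (rowsub_beta alpha beta).
pose ve i : A := RowsubMod (rowsub_alpha alpha beta (delta_mx 0 i)).
pose s := [:: (a, va)]; pose t := [seq (b i, ve i) | i <- index_enum 'I_k].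
have : tensor_eq (tensor_map f s) (tensor_map f t).
  rewrite /tensor_map /= -map_comp /=.
  rewrite {1}[beta]row_sum_delta.
  apply: tensor_eq_trans (tensor_eq_sumr _ _ _) _.
  apply: tensor_eq_map => i /=.
  apply: tensor_eq_trans (tensor_eq_sym (tensor_eq_Z _ _ _)) _.
  apply: tensor_eq_trans (tensor_eq_Z _ _ _).
  suff -> : beta 0 i *: a = alpha *: b i by apply: tensor_eq_refl.
  by apply: val_inj; rewrite !linearZ /= !frac_scaleE -aE -bE /= mulrAC.
move=> /(flatI _ _ _ inj_f)/beta_sum_congr st.
have prod_t : prodJ (beta_sum t).
  rewrite /beta_sum big_map; elim/big_ind: _ => [|x y|i _].
  - exact: set_prod0.
  - exact: set_prodD.
  - apply: prodJ_mem; rewrite -[beta_coef _]subr0.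
    apply: (beta_coef_colon (e := delta_mx 0 i)).
    by rewrite scale0r add0r.
have prod_s : prodJ (beta_sum s - 1).
  rewrite /beta_sum big_seq1 /=; set c := beta_coef va.
  have -> : val a * (c%:F / val a) - 1 = val a * ((c - 1)%:F / val a).
    by rewrite rmorphB rmorph1 mulrBl mulrBr mul1r divff.
  apply: prodJ_mem; apply: (beta_coef_colon (e := 0)).
  by rewrite scale1r scaler0 addr0.
have -> : 1 = beta_sum t + (beta_sum s - beta_sum t) - (beta_sum s - 1).
  by rewrite [beta_sum t + _]addrC subrK subKr.
apply: set_prodD; first exact: set_prodD.
exact: set_prodN (@colonN _ _) prod_s.
Qed.

End CommonDenominator.

(** A weakening of I (D : I) = D: the colon is taken by a finite subset J of I
    only, so that I need not be finitely generated. *)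
Lemma flat_ideal_invertible (J : seq K) : flat (ideal_mod I) ->
  (exists2 a, ideal_set I a & a != 0) -> (forall b, b \in J -> ideal_set I b) ->
  set_prod I (colon [set` J]) 1.
Proof.
move=> flatI [a Ia a0] JI.
have [delta delta0 den] := ideal_denom I.
have Ib (i : 'I_(size J)) : J`_i \in ideal_pred I.
  by apply/asboolP/JI/mem_nth.
have Ia' : a \in ideal_pred I by apply/asboolP.
have [alpha aE] := den _ Ia.
have /choice[beta bE] :
    forall i : 'I_(size J), exists e : D, delta *: J`_i = e%:F.
  by move=> i; apply/den/JI/mem_nth.
have [|s sP ->] := @flat_one_in_prod (size J) delta alpha (\row_i beta i)
  (IdealMod Ia') (fun i => IdealMod (Ib i)) delta0 a0 aE _ flatI.
  by move=> i; rewrite mxE -bE.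
exists s => // p /sP[Ip pJ]; split=> // c cJ; apply: pJ; right.
have cs : (index c J < size J)%N by rewrite index_mem.
by exists (Ordinal cs) => //=; apply: nth_index.
Qed.

(** * Integral dependence *)

(** A monomial of degree i >= 1 in the a / x, multiplied by (t x)^n with n >= i,
    becomes a product of factors t a, which lie in D, times (t x)^(n - i).
    Since i >= 1, the resulting polynomial in t x has degree less than n; this
    strict inequality is what makes the equation for y = 1 monic. *)
Lemma alg_span_colon x y : x != 0 ->
  alg_span (@FracField.tofrac D) [set a / x | a in I] y ->
  exists2 J : seq K, forall b, b \in J -> ideal_set I b &
    forall t, colon [set` J] t -> exists n (q : {poly D}),
      (size q <= n)%N /\
      y * (t * x) ^+ n = (map_poly (@FracField.tofrac D) q).[t * x].
Proof.
move=> x0.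
have catl (J1 J2 : seq K) : [set` J1] `<=` [set` J1 ++ J2].
  by move=> b bJ; rewrite /= mem_cat; apply/orP; left.
have catr (J1 J2 : seq K) : [set` J2] `<=` [set` J1 ++ J2].
  by move=> b bJ; rewrite /= mem_cat; apply/orP; right.
elim=> {y} [_ [a Ia <-]|y z _ [J1 I1 H1] _ [J2 I2 H2]
  |y z _ [J1 I1 H1] _ [J2 I2 H2]|d y _ [J IJ HJ]].
- exists [:: a]; first by move=> b; rewrite inE => /eqP ->.
  move=> t /(_ a) []; first by rewrite /= inE.
  move=> e te; exists 1%N, e%:P; rewrite size_polyC leq_b1; split=> //.
  by rewrite map_polyC hornerC /= -te expr1 [t * x]mulrC mulrA divfK // mulrC.
- exists (J1 ++ J2); first by move=> b; rewrite mem_cat => /orP[/I1|/I2].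
  move=> t tJ.
  have [n [p [sp py]]] := H1 t (colonS (catl _ _) tJ).
  have [m [q [sq qz]]] := H2 t (colonS (catr _ _) tJ).
  exists (n + m)%N, (p * 'X^m + 'X^n * q); split.
    rewrite (leq_trans (size_polyD _ _)) // geq_max; apply/andP; split.
      rewrite (leq_trans (size_polyMleq _ _)) //.
      by rewrite size_polyXn addnS /= leq_add2r.
    rewrite (leq_trans (size_polyMleq _ _)) //.
    by rewrite size_polyXn addSn /= leq_add2l.
  rewrite rmorphD !rmorphM /= !map_polyXn hornerD !hornerM !hornerXn -py -qz.
  by rewrite mulrDl exprD !mulrA [_ ^+ n * z]mulrC.
- exists (J1 ++ J2); first by move=> b; rewrite mem_cat => /orP[/I1|/I2].
  move=> t tJ.
  have [n [p [sp py]]] := H1 t (colonS (catl _ _) tJ).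
  have [m [q [sq qz]]] := H2 t (colonS (catr _ _) tJ).
  exists (n + m)%N, (p * q); split.
    rewrite (leq_trans (size_polyMleq _ _)) // -subn1 leq_subLR.
    by rewrite (leq_trans (leq_add sp sq)).
  by rewrite rmorphM hornerM -py -qz exprD mulrACA.
- exists J => // t /HJ[n [p [sp py]]]; exists n, (d *: p).
  rewrite (leq_trans (size_scale_leq _ _)) //; split=> //.
  by rewrite map_polyZ hornerZ -py mulrA.
Qed.

Lemma colon_integral w n (q : {poly D}) : (size q <= n)%N ->
  w ^+ n = (map_poly (@FracField.tofrac D) q).[w] ->
  integralOver (@FracField.tofrac D) w.
Proof.
move=> sq wq; exists ('X^n - q).
  by rewrite monicE lead_coefDl ?lead_coefXn // size_polyN size_polyXn.
by rewrite /root rmorphB /= map_polyXn hornerD hornerN hornerXn wq subrr.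
Qed.

(** Otherwise some valuation overring V has an ideal Q containing all the a / x
    but not 1, and x in IV would put 1 = x / x in Q. *)
Lemma b_closure_alg_span x : x != 0 -> b_closure I x ->
  alg_span (@FracField.tofrac D) [set a / x | a in I] 1.
Proof.
move=> x0 bIx; apply: contrapT => n1.
have [|V [Q [subV DV valV AQ [Q0 QD QM nQ1]]]] := chevalley _ n1.
  by exists (0 / x); exists 0 => //; have [/asboolP] := ideal_submod I.
have [s sIV xE] := bIx V (ValuationOverring subV DV valV).
apply: nQ1; rewrite -(divff x0) {1}xE mulr_suml big_seq.
elim/big_ind: _ => // p /sIV[Ip Vp]; rewrite mulrAC; apply: QM => //.
by apply: AQ; exists p.1.
Qed.

(** The field K itself is one of the valuation overrings. *)
Lemma b_closure_neq0 x : x != 0 -> b_closure I x ->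
  exists2 a, ideal_set I a & a != 0.
Proof.
move=> x0 /(_ setT)[|s sI xE].
  by split=> [|d|y _]; [split=> [|y z _ _|y z _ _]; apply/asboolP| |left].
apply: contrapT => nI; case/eqP: x0; rewrite xE big_seq big1 // => p /sI[Ip _].
suff -> : p.1 = 0 by rewrite mul0r.
by apply/eqP; apply: contrapT => /negP p0; apply: nI; exists p.1.
Qed.

End FlatIdeal.

Theorem theorem1p7 (D : idomainType) (hD : integrally_closed D)
    (I : fractional_ideal D) (hI : flat (ideal_mod I)) :
  complete I.
Proof.
apply/seteqP; split=> [x bIx|x Ix V [[V1 _ _] _ _]]; last first.
  by rewrite -[x]mulr1; apply: set_prod_mem => //; apply/asboolP.
have [->|x0] := eqVneq x 0.
  by have [/asboolP] := ideal_submod I.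
have [J JI Jint] := alg_span_colon x0 (b_closure_alg_span x0 bIx).
have [s sP one] := flat_ideal_invertible hI (b_closure_neq0 x0 bIx) JI.
suff : x \in ideal_pred I by move/asboolP.
rewrite -[x]mul1r one mulr_suml big_seq; apply: rpred_sum => p /sP[Ip pJ].
have [n [q [sq wq]]] := Jint _ pJ; rewrite mul1r in wq.
have [d wd] := hD _ (colon_integral sq wq).
by rewrite -mulrA mulrC wd -frac_scaleE rpredZ //; apply/asboolP.
Qed.
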